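(* Let $\Omega\subseteq\mathbb{R}^n$ be an open set, let $0<q<2$, and let $A,B:\Omega\to\mathbb{R}$ be continuous functions such that $$A(x)\le A_0,\qquad B(x)\le B_0\qquad\text{for all }x\in\Omega,$$ for some positive constants $A_0,B_0$. Given $\alpha>1$, there is a constant $r_0>0$, depending only on $\alpha$, $q$, $|A_0|$ and $|B_0|$, such that for any ball $B(x_0,2r)\subset\Omega$ with $0<r<r_0$ and every positive viscosity supersolution $u\in\mathrm{LSC}(\Omega)$ of $$\Delta_\infty^N u=A(x)u+B(x)|Du|^q|u|^{1-q}\quad\text{in }\Omega,$$ we have $$\sup_{B(x_0,r/3)}u\le 3^\alpha\inf_{B(x_0,r/3)}u .$$
   Context: $B(x,r)$ is the open ball in $\mathbb{R}^n$ with center $x$ and radius $r$. (The symbol $B$ with a single argument denotes the coefficient function.) $\mathrm{LSC}(\Omega)$ is the class of lower-semicontinuous real-valued functions on $\Omega$. The normalized infinity-Laplacian is formally $\Delta_\infty^N u=|Du|^{-2}\langle D^2u\,Du,Du\rangle$. For a function $\phi$ that is $C^2$ near $x$, put $$\Delta_\infty^{N,-}\phi(x):=\begin{cases}|D\phi(x)|^{-2}\langle D^2\phi(x)D\phi(x),D\phi(x)\rangle,& D\phi(x)\ne 0,\\ \min\{\langle D^2\phi(x)e,e\rangle:|e|=1\},& D\phi(x)=0.\end{cases}$$ A function $u\in\mathrm{LSC}(\Omega)$ is a viscosity supersolution of $\Delta_\infty^N u=H(x,u,Du)$ in $\Omega$ if, whenever $x_0\in\Omega$ and $\phi$ is $C^2$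 in a neighborhood of $x_0$ such that $u-\phi$ has a local minimum at $x_0$, one has $$\Delta_\infty^{N,-}\phi(x_0)\le H(x_0,u(x_0),D\phi(x_0)).$$ Here $H(x,t,p)=A(x)t+B(x)|p|^q|t|^{1-q}$, which is only evaluated at $t=u(x_0)>0$ since $u$ is positive. *)

(* Defs.v *)
From HB Require Import structures.
From mathcomp Require Import all_boot all_order all_algebra.
From mathcomp Require Import all_classical all_reals all_analysis.

Set Implicit Arguments.
Unset Strict Implicit.
Unset Printing Implicit Defensive.

Import Order.TTheory GRing.Theory Num.Theory.
Import numFieldNormedType.Exports.

Local Open Scope classical_set_scope.
Local Open Scope ring_scope.

Section EuclideanSpace.
Context {R : realType} {n : nat}.
Implicit Types (x y p : 'rV[R]_n) (r : R).

Definition inner x y : R := \sum_(i < n) x 0 i * y 0 i.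

(* The library's `|x| on 'rV[R]_n is the sup norm: it induces the same topology
   as enorm, but not the same balls. *)
Definition enorm x : R := Num.sqrt (inner x x).

Definition eball x r : set 'rV[R]_n := [set y | enorm (y - x) < r].

End EuclideanSpace.

Section Calculus.
Context {R : realType} {n : nat}.
Implicit Types (phi : 'rV[R]_n -> R) (x : 'rV[R]_n).

Definition partial (i : 'I_n) phi : 'rV[R]_n -> R :=
  fun x => 'D_(delta_mx 0 i) phi x.

Definition gradient phi x : 'rV[R]_n := \row_i partial i phi x.

Definition hessian phi x : 'M[R]_n :=
  \matrix_(i, j) partial j (partial i phi) x.

Definition C2_near phi x : Prop :=
  \forall y \near x,
    {for y, continuous phi} /\
    forall i : 'I_n,
      [/\ derivable phi y (delta_mx 0 i),
          {for y, continuous (partial i phi)} &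
          forall j : 'I_n,
            derivable (partial i phi) y (delta_mx 0 j) /\
            {for y, continuous (partial j (partial i phi))}].

Definition hess_form phi x (e : 'rV[R]_n) : R :=
  inner (e *m hessian phi x) e.

(* For 0 < n the infimum below is a minimum, hess_form phi x being continuous on
   the compact unit sphere. *)
Definition inf_laplacian_minus phi x : R :=
  if gradient phi x != 0 then
    (enorm (gradient phi x)) ^- 2 * hess_form phi x (gradient phi x)
  else inf [set hess_form phi x e | e in [set e | enorm e = 1]].

End Calculus.

Section Viscosity.
Context {R : realType} {n : nat}.

(* Functions on Omega are represented by total functions whose values outside
   Omega are irrelevant. *)
Definition LSC (Omega : set 'rV[R]_n) (u : 'rV[R]_n -> R) : Prop :=
  lower_semicontinuous (fun x : subspace Omega => (u x)%:E).

(* Omega is meant to be open, so that the neighborhoods of x0 may be taken in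
   the whole space. *)
Definition viscosity_supersolution (Omega : set 'rV[R]_n)
    (H : 'rV[R]_n -> R -> 'rV[R]_n -> R) (u : 'rV[R]_n -> R) : Prop :=
  LSC Omega u /\
  forall (x0 : 'rV[R]_n) (phi : 'rV[R]_n -> R),
    Omega x0 -> C2_near phi x0 ->
    (\forall y \near x0, u x0 - phi x0 <= u y - phi y) ->
    inf_laplacian_minus phi x0 <= H x0 (u x0) (gradient phi x0).

End Viscosity.

(* Main.v *)
Require Import Defs.
From HB Require Import structures.
From mathcomp Require Import all_boot all_order all_algebra.
From mathcomp Require Import all_classical all_reals all_analysis.
From mathcomp Require Import ring lra.

(** The argument is a comparison with power cones. Put [d z = r - |z - x|] and
let [w = C d^alpha]. Since [w] is radial, its normalized infinity-Laplacian off
the vertex [x] is the second derivative of the profile,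
[C alpha (alpha - 1) d^(alpha - 2)], which is positive because [1 < alpha]. At a
point where [w] equals [u], the right-hand side of the equation is at most
[A0 w + B0 |Dw|^q w^(1 - q) = w (A0 + B0 alpha^q d^(-q))]. After division by
[w d^(-2)] one is left with comparing [alpha (alpha - 1)] with
[A0 d^2 + B0 alpha^q d^(2 - q)], and as [q < 2] the latter is smaller as soon as
[d] is ([power_cone_strict]); the resulting threshold for [r] involves neither
[C] nor the dimension. So no supersolution can be touched from below by [w] at
a point other than the vertex.

The multiple of [d^alpha] that touches [u] is found by maximizing
[d^alpha / u], not by minimizing a difference: at the touching point [u] and
[w] then agree, and the term [u^(1 - q)], which is decreasing in [u] for
[1 < q], needs no separate treatment. On the closed ball of radius [r] about
[x] this upper semicontinuous quotient attains its maximum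
([usc_compact_max]). The maximum is positive, hence not attained on the boundary,
where [d = 0]; by the previous paragraph it can only be attained at [x]. This says
[u x (d y / r)^alpha <= u y] ([supersolution_above_power_cone]).

If [x] and [y] lie in the ball of radius [r / 3] about [x0], then
[|y - x| < 2 r / 3], so that [d y / r > 1 / 3] and [u x <= 3^alpha u y]. *)

Set Implicit Arguments.
Unset Strict Implicit.
Unset Printing Implicit Defensive.

Import Order.TTheory GRing.Theory Num.Theory.
Import numFieldNormedType.Exports.

Local Open Scope classical_set_scope.
Local Open Scope ring_scope.

(** * Semicontinuity *)

(** The superlevel sets through the points of [K] form a filter base, being
nested; a cluster point of that filter is a maximizer. *)
Lemma usc_compact_max (T : topologicalType) (R : realType) (f : T -> R)
    (K : set T) :
  K !=set0 -> compact K ->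
  (forall x a, K x -> f x < a -> \forall y \near x, K y -> f y < a) ->
  exists2 x, K x & forall y, K y -> f y <= f x.
Proof.
move=> [k Kk] cK usc.
pose F := filter_from K (fun y => [set x | K x /\ f y <= f x]).
have FF : ProperFilter F.
  apply: filter_from_proper; last by move=> y Ky; exists y; split.
  apply: filter_from_filter; first by exists k.
  move=> i j Ki Kj; have [ij|ji] := leP (f i) (f j).
    by exists j => // x [Kx jx]; split; split => //; apply: le_trans jx.
  by exists i => // x [Kx ix]; split; split => //; apply/ltW/(lt_le_trans ji).
have [|p [Kp clp]] := cK F _; first by exists k => // x [].
exists p => // y Ky; rewrite leNgt; apply/negP => fpy.
have Fy : F [set x | K x /\ f y <= f x] by exists y.
have [z [[Kz yz] /(_ Kz)]] := clp _ _ Fy (usc _ _ Kp fpy).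
by rewrite ltNge yz.
Qed.

Lemma LSC_near (R : realType) (n : nat) (Omega : set 'rV[R]_n)
    (u : 'rV[R]_n -> R) (x : 'rV[R]_n) (c : R) :
  open Omega -> LSC Omega u -> Omega x -> c < u x -> \forall y \near x, c < u y.
Proof.
move=> oO lu Ox cu; have [|V xV h] := lu x c; first by rewrite lte_fin.
have {}xV : \forall y \near x, Omega y -> V y.
  by change (within Omega (nbhs x) V); rewrite nbhs_subspace_in.
have nO : \forall y \near x, Omega y by exact: open_nbhs_nbhs.
by apply: filterS2 xV nO => y Vy Oy; rewrite -lte_fin; exact/h/Vy.
Qed.

(** * The Euclidean norm *)

Section Inner.
Context {R : realType} {n : nat}.
Implicit Types x y e : 'rV[R]_n.

Lemma inner_ge0 x : 0 <= inner x x.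
Proof. by apply: sumr_ge0 => i _; rewrite -expr2 sqr_ge0. Qed.

Lemma innerZl k x y : inner (k *: x) y = k * inner x y.
Proof. by rewrite mulr_sumr; apply: eq_bigr => i _; rewrite mxE mulrA. Qed.

Lemma innerZr k x y : inner x (k *: y) = k * inner x y.
Proof. by rewrite mulr_sumr; apply: eq_bigr => i _; rewrite mxE mulrCA. Qed.

Lemma innerDl x y e : inner (x + y) e = inner x e + inner y e.
Proof. by rewrite -big_split; apply: eq_bigr => i _; rewrite mxE mulrDl. Qed.

Lemma enorm_sqr x : enorm x ^+ 2 = inner x x.
Proof. exact/sqr_sqrtr/inner_ge0. Qed.

Lemma enorm_ge0 x : 0 <= enorm x.
Proof. exact: sqrtr_ge0. Qed.

Lemma enormZ k x : enorm (k *: x) = `|k| * enorm x.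
Proof.
rewrite /enorm innerZl innerZr mulrA -expr2 sqrtrM ?sqr_ge0//.
by rewrite sqrtr_sqr.
Qed.

Lemma enorm0 : enorm (0 : 'rV[R]_n) = 0.
Proof. by rewrite -(scale0r (0 : 'rV[R]_n)) enormZ normr0 mul0r. Qed.

Lemma enormN x : enorm (- x) = enorm x.
Proof. by rewrite -scaleN1r enormZ normrN1 mul1r. Qed.

Lemma inner_eq0 x : inner x x = 0 -> x = 0.
Proof.
move=> /eqP; rewrite psumr_eq0 => [/allP h|i _]; last by rewrite -expr2 sqr_ge0.
apply/rowP => i; rewrite mxE; apply/eqP.
by have := h i (mem_index_enum i); rewrite /= -expr2 sqrf_eq0.
Qed.

Lemma enorm_gt0 x : x != 0 -> 0 < enorm x.
Proof.
move=> x0; rewrite sqrtr_gt0 lt_neqAle inner_ge0 andbT eq_sym.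
by apply: contraNneq x0 => /inner_eq0 ->.
Qed.

(** A consequence of the parallelogram law that stands in for the triangle
inequality: its loss of a factor 2 is harmless at the radii used below. *)
Lemma enormB_sqr_le x y : enorm (x - y) ^+ 2 <= 2 * (enorm x ^+ 2 + enorm y ^+ 2).
Proof.
rewrite !enorm_sqr -big_split mulr_sumr; apply: ler_sum => i _ /=.
rewrite !mxE -subr_ge0.
rewrite (_ : _ - _ = (x 0 i + y 0 i) ^+ 2) ?sqr_ge0//; ring.
Qed.

Lemma coord_le_enorm x i : `|x 0 i| <= enorm x.
Proof.
rewrite -(@ler_pXn2r _ 2) ?nnegrE ?enorm_ge0// enorm_sqr real_normK ?num_real//.
rewrite /inner (bigD1 i)//= -expr2 lerDl.
by apply: sumr_ge0 => j _; rewrite -expr2 sqr_ge0.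
Qed.

End Inner.

(** * The distance to a point *)

Section SquaredDistance.
Context {R : realType} {n : nat}.
Implicit Types x y : 'rV[R]_n.

Lemma is_derive_coord y (v : 'rV[R]_n) i :
  is_derive y v (fun z : 'rV[R]_n => z 0 i) (v 0 i).
Proof.
have df := differentiable_coord y (0 : 'I_1) i.
apply: DeriveDef; first exact: diff_derivable.
rewrite /derive; apply: (@cvg_lim _ _ _) => //.
apply: cvg_near_cst; near=> h; rewrite /= !mxE addrK -[_ *: _]/(_ * _) mulrA.
rewrite mulVf ?mul1r//; near: h; exact: nbhs_dnbhs_neq.
Unshelve. all: by end_near. Qed.

Lemma is_derive_dist_sqr x y (v : 'rV[R]_n) :
  is_derive y v (fun z => inner (z - x) (z - x)) (2 * inner (y - x) v).
Proof.
pose h i := (fun z : 'rV[R]_n => z 0 i) - cst (x 0 i).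
rewrite (_ : (fun z => _) = \sum_(i < n) (h i ^+ 2)); last first.
  apply/funext => z; rewrite /inner fct_sumE; apply: eq_bigr => i _.
  by rewrite !mxE -expr2.
have dh i : is_derive y v (h i) (v 0 i).
  have hi := is_derive_coord y v i.
  by apply: is_derive_eq; rewrite subr0.
apply: is_derive_eq; rewrite /inner mulr_sumr; apply: eq_bigr => i _.
by rewrite !mxE /h /= expr1 -[_ *: _]/(_ * _) /= mulrA.
Qed.

Lemma differentiable_dist_sqr x y :
  differentiable (fun z : 'rV[R]_n => inner (z - x) (z - x)) y.
Proof.
rewrite (_ : (fun z => _) =
    \sum_(i < n) (((fun z : 'rV[R]_n => z 0 i) - cst (x 0 i)) ^+ 2)).
  apply: differentiable_sum => i; apply: differentiableX.
  apply: differentiableB; last exact: differentiable_cst.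
  exact: differentiable_coord.
apply/funext => z; rewrite /inner fct_sumE; apply: eq_bigr => i _.
by rewrite !mxE -expr2.
Qed.

End SquaredDistance.

Section Ball.
Context {R : realType} {n : nat}.
Implicit Types x y : 'rV[R]_n.

Lemma continuous_dist x : continuous (fun y : 'rV[R]_n => enorm (y - x)).
Proof.
move=> y; pose Q (z : 'rV[R]_n) := inner (z - x) (z - x).
suff: {for y, continuous (@Num.sqrt R \o Q)} by [].
apply: continuous_comp; last exact: sqrt_continuous.
exact/differentiable_continuous/differentiable_dist_sqr.
Qed.

Lemma compact_closed_ball x r : compact [set y | enorm (y - x) <= r].
Proof.
apply: bounded_closed_compact; last first.
  apply: (@closed_comp _ _ _ [set t | t <= r]); last exact: closed_le.
  by move=> y _; exact: continuous_dist.
exists (r + `|x|); split; first exact: num_real.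
move=> M rM y /= yr; rewrite -(subrK x y).
apply: (le_trans (ler_normD _ _)); apply: ltW; apply: le_lt_trans rM.
rewrite lerD2r {1}/Num.norm /= mx_normrE; apply: bigmax_le.
  exact: le_trans (enorm_ge0 _) yr.
by move=> [i j] _ /=; rewrite ord1; apply: le_trans (coord_le_enorm _ _) yr.
Qed.
End Ball.

(** * Radial functions *)

Lemma is_derive_comp1 (R : realType) (V : normedModType R) (f : R -> R)
    (g : V -> R) (y v : V) (df dg : R) :
  is_derive (g y) 1 f df -> differentiable g y -> is_derive y v g dg ->
  is_derive y v (f \o g) (df * dg).
Proof.
move=> [/derivable1_diffP ff fE] gg [_ gE].
apply: DeriveDef; first exact/diff_derivable/differentiable_comp.
rewrite deriveE; last exact: differentiable_comp.
rewrite diff_comp//= -(deriveE v gg) gE diff1E// -[_ *: _]/(_ * _) mulrC.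
by rewrite derive1E fE.
Qed.

Section Radial.
Context {R : realType} {n : nat} (x : 'rV[R]_n) (f f1 f2 : R -> R) (I : set R).
Hypothesis oI : open I.
Hypothesis df : forall s, I s -> is_derive s 1 f (f1 s).
Hypothesis df1 : forall s, I s -> is_derive s 1 f1 (f2 s).
Hypothesis cf2 : forall s, I s -> {for s, continuous f2}.

Let Q (z : 'rV[R]_n) : R := inner (z - x) (z - x).
Let phi := f \o Q.

Let Q_continuous : continuous Q.
Proof. by move=> z; exact/differentiable_continuous/differentiable_dist_sqr. Qed.

Let near_I y : I (Q y) -> \forall z \near y, I (Q z).
Proof. by move=> Iy; apply: Q_continuous; exact: open_nbhs_nbhs. Qed.

Let inner_delta (e : 'rV[R]_n) i : inner e (delta_mx 0 i) = e 0 i.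
Proof.
rewrite /inner (bigD1 i)//= big1 ?addr0 => [|j ji].
  by rewrite mxE !eqxx mulr1.
by rewrite mxE (negbTE ji) andbF mulr0.
Qed.

Lemma is_derive_radial y i : I (Q y) ->
  is_derive y (delta_mx 0 i) phi (2 * f1 (Q y) * (y - x) 0 i).
Proof.
move=> Iy; have fy := df Iy.
have := is_derive_comp1 fy (differentiable_dist_sqr x y)
  (is_derive_dist_sqr x y (delta_mx 0 i)).
by rewrite inner_delta mulrA (mulrC _ 2).
Qed.

Lemma partial_radial y i : I (Q y) ->
  partial i phi y = 2 * f1 (Q y) * (y - x) 0 i.
Proof. by move=> Iy; have := is_derive_radial i Iy => h; rewrite /partial derive_val. Qed.

Let near_partial y i : I (Q y) ->
  \forall z \near y, 2 * f1 (Q z) * (z - x) 0 i = partial i phi z.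
Proof. by move=> /near_I; apply: filterS => z /partial_radial ->. Qed.

Lemma is_derive_partial_radial y i j : I (Q y) ->
  is_derive y (delta_mx 0 j) (partial i phi)
    (4 * f2 (Q y) * (y - x) 0 i * (y - x) 0 j + 2 * f1 (Q y) * (i == j)%:R).
Proof.
move=> Iy; apply: near_eq_is_derive (near_partial i Iy) _.
have f1y := df1 Iy.
have d1 := is_derive_comp1 f1y (differentiable_dist_sqr x y)
  (is_derive_dist_sqr x y (delta_mx 0 j)).
have d2 := is_derive_coord y (delta_mx 0 j) i.
rewrite (_ : (fun z => _) = (cst 2 * (f1 \o Q)) *
    ((fun z : 'rV[R]_n => z 0 i) - cst (x 0 i))); last first.
  by apply/funext => z; rewrite !fctE !mxE.
apply: is_derive_eq.
rewrite !fctE inner_delta !mxE eqxx /= -![_ *: _]/(_ * _).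
ring.
Qed.

Lemma partial_partial_radial y i j : I (Q y) ->
  partial j (partial i phi) y =
    4 * f2 (Q y) * (y - x) 0 i * (y - x) 0 j + 2 * f1 (Q y) * (i == j)%:R.
Proof.
by move=> Iy; have h := is_derive_partial_radial i j Iy; rewrite {1}/partial derive_val.
Qed.

Let coord_cont i : continuous (fun z : 'rV[R]_n => (z - x) 0 i).
Proof.
move=> y; rewrite (_ : (fun z => _) =
    (fun z : 'rV[R]_n => z 0 i) - cst (x 0 i)); last first.
  by apply/funext => z; rewrite !mxE.
apply: differentiable_continuous; apply: differentiableB => //.
exact: differentiable_coord.
Qed.

Let comp_cont (g : R -> R) (y : 'rV[R]_n) :
  {for Q y, continuous g} -> {for y, continuous (g \o Q)}.
Proof. by move=> gc; apply: continuous_comp => //; exact: Q_continuous. Qed.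

Let derive_cont (g : R -> R) (s d : R) : is_derive s 1 g d -> {for s, continuous g}.
Proof. by move=> [/derivable1_diffP h _]; exact: differentiable_continuous. Qed.

(** The set [I] avoids 0 in the applications: a radial function with a vertex,
like a cone, is smooth only away from it. *)
Lemma C2_near_radial y : I (Q y) -> C2_near phi y.
Proof.
move=> /near_I; apply: filterS => z Iz; split.
  exact/comp_cont/(derive_cont (df Iz)).
have cf1 : {for z, continuous (f1 \o Q)}.
  exact/comp_cont/(derive_cont (df1 Iz)).
have cf2Q : {for z, continuous (f2 \o Q)} by exact/comp_cont/cf2.
have cst_cont (c : R) : {for z, continuous (fun=> c)} by exact: cst_continuous.
move=> i; split.
- by have [] := is_derive_radial i Iz.
- rewrite /prop_for /continuous_at partial_radial//.
  apply: cvg_trans (near_eq_cvg (near_partial i Iz)) _.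
  exact: (continuousM (continuousM (cst_cont 2) cf1) (@coord_cont i z)).
move=> j; split; first by have [] := is_derive_partial_radial i j Iz.
rewrite /prop_for /continuous_at partial_partial_radial//.
have nearP : \forall t \near z,
   4 * f2 (Q t) * (t - x) 0 i * (t - x) 0 j + 2 * f1 (Q t) * (i == j)%:R =
   partial j (partial i phi) t.
  by move: (near_I Iz); apply: filterS => t /partial_partial_radial ->.
apply: cvg_trans (near_eq_cvg nearP) _.
exact: (continuousD
  (continuousM (continuousM (continuousM (cst_cont 4) cf2Q)
    (@coord_cont i z)) (@coord_cont j z))
  (continuousM (continuousM (cst_cont 2) cf1) (cst_cont (i == j)%:R))).
Qed.

Lemma gradient_radial y : I (Q y) ->
  gradient phi y = (2 * f1 (Q y)) *: (y - x).
Proof. by move=> Iy; apply/rowP => i; rewrite !mxE partial_radial// !mxE. Qed.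

(** The Hessian is [4 f2 p p^T + 2 f1 Id] with [p = y - x], so [p] is an
eigenvector. *)
Lemma hess_form_radial y k : I (Q y) ->
  hess_form phi y (k *: (y - x)) =
  k ^+ 2 * Q y * (4 * f2 (Q y) * Q y + 2 * f1 (Q y)).
Proof.
move=> Iy; rewrite /hess_form; set p := y - x.
have -> : hessian phi y = (4 * f2 (Q y)) *: (p^T *m p) + (2 * f1 (Q y))%:M.
  apply/matrixP => i j; rewrite [LHS]mxE partial_partial_radial// !mxE big_ord1.
  by rewrite ![p^T _ _]mxE /p !mxE mulr_natr; ring.
rewrite mulmxDr mul_mx_scalar -scalemxAr mulmxA.
rewrite innerDl !innerZl -scalemxAl !innerZr -scalemxAl.
have -> : p *m p^T *m p = Q y *: p.
  rewrite [p *m p^T]mx11_scalar mul_scalar_mx; congr (_ *: _).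
  by rewrite mxE; apply: eq_bigr => i _; rewrite [p^T _ _]mxE.
rewrite !innerZl -/(Q y); ring.
Qed.

(** The gradient is a multiple of [y - x], hence only the eigenvalue of the
Hessian in the radial direction survives; it is the second derivative of
[t |-> f (t ^+ 2)] at [t = enorm (y - x)]. *)
Lemma inf_laplacian_minus_radial y : I (Q y) -> y != x -> f1 (Q y) != 0 ->
  inf_laplacian_minus phi y = 4 * Q y * f2 (Q y) + 2 * f1 (Q y).
Proof.
move=> Iy yx f10; have Q0 : Q y != 0.
  by apply: contraNneq yx => /inner_eq0/eqP; rewrite subr_eq0.
rewrite /inf_laplacian_minus gradient_radial// scaler_eq0 subr_eq0 (negbTE yx).
rewrite orbF mulf_eq0 pnatr_eq0/= f10 hess_form_radial//.
rewrite enorm_sqr innerZl innerZr -/(Q y).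
by field; rewrite Q0 f10.
Qed.

End Radial.

(** * Power cones *)

Section Profile.
Context {R : realType} (C r a : R).

(** The profile of the power cone as a function of the squared distance [s] to
the vertex: the squared distance is a polynomial in the coordinates, so that all
non-smoothness is confined to one real variable. *)
Definition cone_profile (s : R) : R := C * (r - Num.sqrt s) `^ a.

Definition cone_profile_d1 (s : R) : R :=
  - (C * a / 2) * ((r - Num.sqrt s) `^ (a - 1) * (Num.sqrt s)^-1).

Definition cone_profile_d2 (s : R) : R :=
  C * a * (a - 1) * (r - Num.sqrt s) `^ (a - 1 - 1) / (4 * Num.sqrt s ^+ 2) +
  C * a * (r - Num.sqrt s) `^ (a - 1) / (4 * Num.sqrt s ^+ 3).

Let sqrt_lt s : 0 < r -> s \in `]0, r ^+ 2[ -> 0 < Num.sqrt s < r.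
Proof.
move=> r0; rewrite in_itv/= => /andP[s0 sr]; rewrite sqrtr_gt0 s0/=.
rewrite -(@ltr_pXn2r _ 2) ?nnegrE ?sqrtr_ge0 ?(ltW r0)//.
by rewrite sqr_sqrtr// ltW.
Qed.

Lemma is_derive_powR_dist (b s : R) : 0 < r -> s \in `]0, r ^+ 2[ ->
  is_derive s 1 (fun s => (r - Num.sqrt s) `^ b)
    (- b * (r - Num.sqrt s) `^ (b - 1) / (2 * Num.sqrt s)).
Proof.
move=> r0 sI; have /andP[t0 tr] := sqrt_lt r0 sI.
have s0 : 0 < s by rewrite -sqrtr_gt0.
have d1 : is_derive s 1 (cst r - Num.sqrt) (- (2 * Num.sqrt s)^-1).
  have h := is_derive1_sqrt s0.
  by have := is_deriveB (is_derive_cst r s 1) h; rewrite sub0r.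
have d2 : is_derive ((cst r - Num.sqrt) s) 1 (fun t : R => t `^ b)
    (b * (r - Num.sqrt s) `^ (b - 1)).
  by apply: is_derive1_powR; rewrite !fctE /= subr_gt0.
have := is_derive1_comp d2 d1.
by rewrite mulrN -mulNr -mulNr.
Qed.

Lemma is_derive_cone_profile s : 0 < r -> s \in `]0, r ^+ 2[ ->
  is_derive s 1 cone_profile (cone_profile_d1 s).
Proof.
move=> r0 sI; have /andP[t0 tr] := sqrt_lt r0 sI.
have h := is_derive_powR_dist a r0 sI.
apply: is_derive_eq; rewrite /cone_profile_d1 /= -![_ *: _]/(_ * _).
by field; rewrite gt_eqF.
Qed.

Lemma is_derive_cone_profile_d1 s : 0 < r -> s \in `]0, r ^+ 2[ ->
  is_derive s 1 cone_profile_d1 (cone_profile_d2 s).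
Proof.
move=> r0 sI; have /andP[t0 tr] := sqrt_lt r0 sI.
have s0 : 0 < s by rewrite -sqrtr_gt0.
have h := is_derive_powR_dist (a - 1) r0 sI.
have h2 := is_derive1_sqrt s0.
have h3 : is_derive s 1 (fun s => (Num.sqrt s)^-1 : R)
    (- Num.sqrt s ^- 2 *: (2 * Num.sqrt s)^-1).
  by apply: is_deriveV => //; rewrite gt_eqF.
rewrite /cone_profile_d1; apply: is_derive_eq.
rewrite /cone_profile_d2 /= -![_ *: _]/(_ * _).
by field; rewrite gt_eqF.
Qed.

Lemma continuous_cone_profile_d2 s : 0 < r -> s \in `]0, r ^+ 2[ ->
  {for s, continuous cone_profile_d2}.
Proof.
move=> r0 sI; have /andP[t0 tr] := sqrt_lt r0 sI.
have c0 := @sqrt_continuous R s.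
have c1 (b : R) : {for s, continuous (fun s => (r - Num.sqrt s) `^ b)}.
  have [/derivable1_diffP h _] := is_derive_powR_dist b r0 sI.
  exact: differentiable_continuous.
have cc (c : R) : {for s, continuous (fun=> c)} by exact: cst_continuous.
apply: continuousD.
  apply: continuousM; first exact: continuousM (cc _) (c1 _).
  apply: continuousV; first by rewrite mulf_neq0 ?expf_neq0 ?gt_eqF.
  apply: continuousM; first exact: cc.
  exact: (continuous_comp c0 (@exprn_continuous R 2 _)).
apply: continuousM; first exact: continuousM (cc _) (c1 _).
apply: continuousV; first by rewrite mulf_neq0 ?expf_neq0 ?gt_eqF.
apply: continuousM; first exact: cc.
exact: (continuous_comp c0 (@exprn_continuous R 3 _)).
Qed.
End Profile.

Section Cone.
Context {R : realType} {n : nat} (C r a : R) (x y : 'rV[R]_n).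
Hypotheses (C0 : 0 < C) (r0 : 0 < r) (a0 : 0 < a).
Hypotheses (yx : y != x) (yr : enorm (y - x) < r).

Definition power_cone (z : 'rV[R]_n) : R := C * (r - enorm (z - x)) `^ a.

Let Q_in : `]0, r ^+ 2[%classic (inner (y - x) (y - x)).
Proof.
rewrite /= in_itv/= -enorm_sqr exprn_gt0 ?enorm_gt0 ?subr_eq0//=.
by rewrite ltr_pXn2r ?nnegrE ?enorm_ge0 ?(ltW r0).
Qed.

Let oI : open (`]0, r ^+ 2[%classic : set R).
Proof. exact: interval_open. Qed.

Let df s : `]0, r ^+ 2[%classic s ->
  is_derive s 1 (cone_profile C r a) (cone_profile_d1 C r a s).
Proof. exact: is_derive_cone_profile. Qed.

Let df1 s : `]0, r ^+ 2[%classic s ->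
  is_derive s 1 (cone_profile_d1 C r a) (cone_profile_d2 C r a s).
Proof. exact: is_derive_cone_profile_d1. Qed.

Let cf2 s : `]0, r ^+ 2[%classic s ->
  {for s, continuous (cone_profile_d2 C r a)}.
Proof. exact: continuous_cone_profile_d2. Qed.

Let d := r - enorm (y - x).

Let cone_profile_d1E : cone_profile_d1 C r a (inner (y - x) (y - x)) =
  - (C * a / 2) * (d `^ (a - 1) * (enorm (y - x))^-1).
Proof. by []. Qed.

Lemma C2_near_power_cone : C2_near power_cone y.
Proof. exact: (C2_near_radial oI df df1 cf2 Q_in). Qed.

Lemma enorm_gradient_power_cone :
  enorm (gradient power_cone y) = C * a * d `^ (a - 1).
Proof.
have t0 : 0 < enorm (y - x) by rewrite enorm_gt0// subr_eq0.
have d0 : 0 < d by rewrite subr_gt0.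
rewrite [gradient _ _](gradient_radial df Q_in).
rewrite enormZ cone_profile_d1E mulNr mulrN normrN ger0_norm.
  by field; rewrite gt_eqF.
by rewrite !mulr_ge0 ?invr_ge0 ?powR_ge0 ?ltW.
Qed.

Lemma inf_laplacian_power_cone :
  inf_laplacian_minus power_cone y = C * a * (a - 1) * d `^ (a - 1 - 1).
Proof.
have t0 : 0 < enorm (y - x) by rewrite enorm_gt0// subr_eq0.
have d0 : 0 < d by rewrite subr_gt0.
have c0 : cone_profile_d1 C r a (inner (y - x) (y - x)) != 0.
  rewrite cone_profile_d1E mulf_eq0 oppr_eq0 !mulf_eq0 !invr_eq0 pnatr_eq0.
  by rewrite !gt_eqF// powR_gt0.
rewrite [LHS](inf_laplacian_minus_radial oI df df1 Q_in yx c0).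
rewrite cone_profile_d1E /cone_profile_d2 -/(enorm _) -/d -enorm_sqr.
by field; rewrite gt_eqF.
Qed.
End Cone.

Lemma powR_small (R : realType) (p e : R) : 0 < p -> 0 < e ->
  exists2 d0 : R, 0 < d0 & forall d, 0 < d -> d < d0 -> d `^ p < e.
Proof.
move=> p0 e0; exists (e `^ p^-1); first exact: powR_gt0.
move=> d d0 de; rewrite -[ltRHS]powRr1 ?ltW// -(mulVf (lt0r_neq0 p0)) powRrM.
by rewrite gt0_ltr_powR// ?nnegrE ?powR_ge0// ltW.
Qed.

(** [C * d `^ a] and its first and second derivatives in [d] are the value, the
gradient norm and the normalized infinity-Laplacian of a power cone: the
inequality makes every power cone of radius [r] a strict subsolution, off its
vertex, of the equation with constant coefficients [A0] and [B0]. *)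
Definition strict_subsolution_cones (R : realType) (a q A0 B0 r : R) : Prop :=
  forall C d, 0 < C -> 0 < d -> d < r ->
    A0 * (C * d `^ a)
      + B0 * (C * a * d `^ (a - 1)) `^ q * (C * d `^ a) `^ (1 - q)
    < C * a * (a - 1) * d `^ (a - 1 - 1).

(** Dividing by [C * d `^ a / d ^+ 2] turns the claim into
[A0 d^2 + B0 a^q d^(2 - q) < a (a - 1)]; each of the two terms on the left is
made smaller than half of the right-hand side. *)
Lemma power_cone_strict (R : realType) (a q A0 B0 : R) :
  0 < A0 -> 0 < B0 -> 1 < a -> q < 2 ->
  exists2 r0 : R, 0 < r0 & strict_subsolution_cones a q A0 B0 r0.
Proof.
move=> A0p B0p a1 q2; pose k := a * (a - 1) / 2.
have a0 : 0 < a by lra.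
have k0 : 0 < k by rewrite divr_gt0// mulr_gt0// subr_gt0.
have ap : 0 < a `^ q by exact: powR_gt0.
have [r1 r10 h1] := powR_small (ltr0Sn R 1) (divr_gt0 k0 A0p).
have [r2 r20 h2] := @powR_small _ (2 - q) _ (ltac:(lra)) (divr_gt0 k0 (mulr_gt0 B0p ap)).
exists (Num.min r1 r2); first by rewrite lt_min r10.
move=> C d C0 d0; rewrite lt_min => /andP[/(h1 _ d0) {}h1 /(h2 _ d0) {}h2].
have dn0 : d != 0 by rewrite gt_eqF.
have w0 : 0 < C * d `^ a by rewrite mulr_gt0// powR_gt0.
have wE : d `^ (a - 1) = d `^ a / d by rewrite powRB ?dn0 ?implybT// powRr1// ltW.
have wE2 : d `^ (a - 1 - 1) = d `^ a / d ^+ 2.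
  rewrite powRB ?dn0 ?implybT// powRr1 ?ltW// wE; by field.
have gE : C * a * d `^ (a - 1) = C * d `^ a * (a / d) by rewrite wE; field.
rewrite gE powRM ?divr_ge0 ?(ltW w0) ?(ltW a0) ?(ltW d0)//.
have -> : B0 * ((C * d `^ a) `^ q * (a / d) `^ q) * (C * d `^ a) `^ (1 - q) =
    C * d `^ a * (B0 * (a / d) `^ q).
  rewrite -[in RHS](@powRr1 _ (C * d `^ a)) ?(ltW w0)//.
  have -> : (C * d `^ a) `^ 1 = (C * d `^ a) `^ q * (C * d `^ a) `^ (1 - q).
    by rewrite -powRD ?(gt_eqF w0) ?implybT//; congr (_ `^ _); ring.
  ring.
rewrite wE2.
have -> : C * a * (a - 1) * (d `^ a / d ^+ 2) =
    C * d `^ a * (a * (a - 1) / d ^+ 2) by ring.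
rewrite mulrC -mulrDr ltr_pM2l// ltr_pdivlMr ?exprn_gt0// mulrDl.
have e2 : d `^ 2 = d ^+ 2 by rewrite powR_mulrn// ltW.
have -> : a * (a - 1) = k + k by rewrite /k; field.
rewrite ltr_pdivlMr// e2 in h1; rewrite ltr_pdivlMr ?mulr_gt0// in h2.
apply: ltrD; first by rewrite mulrC.
suff -> : B0 * (a / d) `^ q * d ^+ 2 = d `^ (2 - q) * (B0 * a `^ q) by [].
rewrite powRB ?dn0 ?implybT// e2 powRM ?invr_ge0 ?(ltW a0) ?(ltW d0)//.
have -> : d^-1 `^ q = (d `^ q)^-1.
  by rewrite -[d^-1]powR_inv1 ?(ltW d0)// -!powRrM mulN1r powRN.
ring.
Qed.

(** * Comparison of supersolutions with power cones *)

(** The quotient [d / v] with [v = u^(1/a)] is maximized over the closed ball: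
its [a]-th power is [d^a / u], and taking the root of [u] leaves [d] as a
continuous numerator. At a maximizer [z] other than the vertex,
[(d / M)^a] with [M = d z / v z] touches [u] from below, which the strict
inequality forbids. *)
Lemma supersolution_above_power_cone (R : realType) (n : nat)
    (Omega : set 'rV[R]_n) (A B u : 'rV[R]_n -> R) (a q A0 B0 r : R)
    (x : 'rV[R]_n) :
  open Omega ->
  (forall y, Omega y -> A y <= A0) -> (forall y, Omega y -> B y <= B0) ->
  (forall y, Omega y -> 0 < u y) ->
  viscosity_supersolution Omega
    (fun y t p => A y * t + B y * enorm p `^ q * `|t| `^ (1 - q)) u ->
  0 < a -> 0 < r ->
  strict_subsolution_cones a q A0 B0 r ->
  [set y | enorm (y - x) <= r] `<=` Omega ->
  forall y, enorm (y - x) <= r ->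
    u x * ((r - enorm (y - x)) / r) `^ a <= u y.
Proof.
move=> oO hA hB u0 [lu visc] a0 r0 strict KO y Ky.
pose K := [set y | enorm (y - x) <= r].
pose d z := r - enorm (z - x).
pose v z := u z `^ a^-1.
have a_neq0 : a != 0 by rewrite gt_eqF.
have enorm_xx : enorm (x - x) = 0 by rewrite subrr enorm0.
have Kx : K x by rewrite /K /= enorm_xx ltW.
have v0 z : K z -> 0 < v z by move=> /KO/u0; exact: powR_gt0.
have d0 z : K z -> 0 <= d z by rewrite subr_ge0.
have vK z : K z -> v z `^ a = u z.
  by move=> /KO/u0 uz; rewrite /v -powRrM mulVf// powRr1// ltW.
have [z Kz zmax] : exists2 z, K z & forall y, K y -> d y / v y <= d z / v z.
  apply: usc_compact_max; [by exists x|exact: compact_closed_ball|].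
  move=> z b Kz; rewrite ltr_pdivrMr ?v0// => dz.
  have b0 : 0 < b by rewrite -(pmulr_lgt0 _ (v0 _ Kz)) (le_lt_trans (d0 _ Kz)).
  (* c separates d z / b from v z: near z, d < b c while v > c. *)
  pose c := (d z / b + v z) / 2.
  have dbv : d z / b < v z by rewrite ltr_pdivrMr// mulrC.
  have db0 : 0 <= d z / b by rewrite divr_ge0 ?d0 ?ltW.
  have cv : c < v z by rewrite /c; lra.
  have c0 : 0 < c by have := v0 _ Kz; rewrite /c; lra.
  have dc : d z < b * c by rewrite mulrC -ltr_pdivrMr// /c; lra.
  have near_u : \forall t \near z, c `^ a < u t.
    apply: (LSC_near oO lu (KO _ Kz)); rewrite -(vK _ Kz).
    by rewrite gt0_ltr_powR// ?nnegrE ltW// v0.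
  have near_d : \forall t \near z, d t < b * c.
    have cd : {for z, continuous d}.
      by apply: continuousB; [exact: cst_continuous|exact: continuous_dist].
    exact: (cvgr_lt _ cd).
  near=> t => Kt; rewrite ltr_pdivrMr ?v0//.
  apply: (@lt_trans _ _ (b * c)); first by near: t.
  rewrite ltr_pM2l// ltNge; apply/negP => vc.
  have : c `^ a < u t by near: t.
  rewrite -(vK _ Kt) ltNge => /negP; apply.
  by rewrite ge0_ler_powR ?nnegrE ?(ltW a0) ?(ltW c0) ?(ltW (v0 _ Kt)).
have [zx|zx] := eqVneq z x.
  have := zmax _ Ky; rewrite zx {2}/d enorm_xx subr0 => hy.
  have dv : v x * (d y / r) <= v y.
    have vx := v0 _ Kx; have vy := v0 _ Ky.
    rewrite mulrA ler_pdivrMr// mulrC.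
    by move: hy; rewrite ler_pdivrMr// mulrAC ler_pdivlMr// mulrC (mulrC r).
  rewrite -(vK _ Kx) -(vK _ Ky) -powRM ?(ltW (v0 _ Kx)) ?divr_ge0 ?d0 ?(ltW r0)//.
  rewrite ge0_ler_powR ?nnegrE ?(ltW a0) ?(ltW (v0 _ Ky))//.
  by rewrite mulr_ge0 ?(ltW (v0 _ Kx)) ?divr_ge0 ?d0 ?(ltW r0).
exfalso.
(* z differs from x: a power cone touches u from below at z. *)
pose M := d z / v z.
have M0 : 0 < M.
  apply: lt_le_trans (zmax _ Kx); rewrite {1}/d enorm_xx subr0.
  by rewrite divr_gt0 ?v0.
have dz : 0 < d z by rewrite -(pmulr_lgt0 _ (_ : 0 < (v z)^-1)) ?invr_gt0 ?v0.
have zr : enorm (z - x) < r by rewrite -subr_gt0.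
pose C := (M^-1) `^ a.
have C0 : 0 < C by rewrite powR_gt0// invr_gt0.
pose phi := power_cone C r a x.
have phi_le t : K t -> phi t <= u t.
  move=> Kt; rewrite /phi /power_cone /C -powRM ?invr_ge0 ?(ltW M0) ?(d0 _ Kt)//.
  rewrite -(vK _ Kt) ge0_ler_powR ?nnegrE ?(ltW a0) ?(ltW (v0 _ Kt))//.
    by rewrite mulr_ge0 ?invr_ge0 ?(ltW M0) ?(d0 _ Kt).
  by rewrite mulrC ler_pdivrMr// mulrC -ler_pdivrMr ?v0// zmax.
have phiz : phi z = u z.
  rewrite /phi /power_cone /C -powRM ?invr_ge0 ?(ltW M0) ?(d0 _ Kz)//.
  rewrite -(vK _ Kz); congr (_ `^ _); rewrite -/(d z) /M.
  by field; rewrite !gt_eqF ?v0.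
have touch : \forall t \near z, u z - phi z <= u t - phi t.
  have near_K : \forall t \near z, enorm (t - x) < r.
    have cd := @continuous_dist _ _ x z; exact: (cvgr_lt _ cd).
  by apply: filterS near_K => t /ltW Kt; rewrite phiz subrr subr_ge0 phi_le.
have Oz := KO _ Kz.
have C2phi : C2_near phi z by exact: C2_near_power_cone.
have := visc z phi Oz C2phi touch.
rewrite inf_laplacian_power_cone// enorm_gradient_power_cone// -/(d z).
rewrite -phiz leNgt => /negP; apply.
have dr : d z < r by rewrite ltrBlDr ltrDl enorm_gt0// subr_eq0.
apply: le_lt_trans (strict C (d z) C0 dz dr).
rewrite phiz ger0_norm ?(ltW (u0 _ Oz))// -phiz lerD//.
  by rewrite ler_wpM2r ?hA// phiz ltW// u0.
by rewrite !ler_wpM2r ?powR_ge0 ?hB.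
Unshelve. all: by end_near. Qed.

(** * The Harnack inequality *)

Theorem theorem2p1 (R : realType) (alpha q A0 B0 : R)
    (hq0 : 0 < q) (hq2 : q < 2) (hA0 : 0 < A0) (hB0 : 0 < B0)
    (halpha : 1 < alpha) :
  exists2 r0 : R, 0 < r0 &
    forall (n : nat) (Omega : set 'rV[R]_n) (A B : 'rV[R]_n -> R),
      (0 < n)%N ->
      open Omega ->
      {within Omega, continuous A} ->
      {within Omega, continuous B} ->
      (forall x, Omega x -> A x <= A0) ->
      (forall x, Omega x -> B x <= B0) ->
      forall (x0 : 'rV[R]_n) (r : R),
        0 < r -> r < r0 ->
        eball x0 (2 * r) `<=` Omega ->
        forall u : 'rV[R]_n -> R,
          (forall x, Omega x -> 0 < u x) ->
          viscosity_supersolution Omega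
            (fun x t p => A x * t + B x * enorm p `^ q * `|t| `^ (1 - q)) u ->
          (ereal_sup [set (u x)%:E | x in eball x0 (r / 3)]
           <= (3 `^ alpha)%:E
              * ereal_inf [set (u x)%:E | x in eball x0 (r / 3)])%E.
Proof.
have [r0 r00 strict] := power_cone_strict hA0 hB0 halpha hq2.
exists r0 => // n Omega A B _ oO _ _ hA hB x0 r rp rr0 ballO u u0 su.
have a0 : 0 < alpha by lra.
have r2 : 0 < r ^+ 2 by rewrite exprn_gt0.
have sqr_lt x : eball x0 (r / 3) x -> enorm (x - x0) ^+ 2 < r ^+ 2 / 9.
  rewrite /eball /= => xr.
  have -> : r ^+ 2 / 9 = (r / 3) ^+ 2 by field.
  by rewrite ltr_pXn2r ?nnegrE ?enorm_ge0// divr_ge0// ltW.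
have sub2 (x y z : 'rV[R]_n) : x - y = (x - z) - (y - z).
  by rewrite opprB addrA subrK.
(* The closed ball of radius r about x stays in Omega, and y is at distance less
   than 2 r / 3 from x: for the squares in units of r^2, 2 (1 + 1/9) < 4 and
   2 (1/9 + 1/9) = 4/9. *)
have harnack x y : eball x0 (r / 3) x -> eball x0 (r / 3) y ->
    u x <= 3 `^ alpha * u y.
  move=> xB yB; have xr := sqr_lt _ xB; have yr := sqr_lt _ yB.
  have KO : [set z | enorm (z - x) <= r] `<=` Omega.
    move=> z /= zr; apply: ballO; rewrite /eball /=.
    have zr2 : enorm (z - x) ^+ 2 <= r ^+ 2.
      by rewrite ler_pXn2r ?nnegrE ?enorm_ge0// ltW.
    rewrite -(@ltr_pXn2r _ 2) ?nnegrE ?enorm_ge0 ?mulr_ge0 ?(ltW rp)//.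
    have := enormB_sqr_le (z - x) (x0 - x); rewrite -sub2.
    rewrite -[x0 - x]opprB enormN; lra.
  have yx : enorm (y - x) < 2 * r / 3.
    rewrite -(@ltr_pXn2r _ 2) ?nnegrE ?enorm_ge0 ?divr_ge0 ?mulr_ge0 ?(ltW rp)//.
    have := enormB_sqr_le (y - x0) (x - x0); rewrite -sub2.
    have -> : (2 * r / 3) ^+ 2 = 2 * (r ^+ 2 / 9 + r ^+ 2 / 9) by field.
    lra.
  have yxr : enorm (y - x) <= r by lra.
  have ux : 0 < u x by apply/u0/KO; rewrite /= subrr enorm0 ltW.
  have strict_r : strict_subsolution_cones alpha q A0 B0 r.
    by move=> C d C0 d0 dr; apply: strict => //; exact: lt_trans rr0.
  have := supersolution_above_power_cone oO hA hB u0 su a0 rp strict_r KO yxr.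
  have third : (3 : R)^-1 `^ alpha <= ((r - enorm (y - x)) / r) `^ alpha.
    have d3 : (3 : R)^-1 <= (r - enorm (y - x)) / r by rewrite ler_pdivlMr//; lra.
    by rewrite ge0_ler_powR ?nnegrE ?(ltW a0)// (le_trans _ d3).
  move=> le_uy; have -> : u x = 3 `^ alpha * (u x * (3 : R)^-1 `^ alpha).
    by rewrite mulrCA -powRM// divff// powR1 mulr1.
  rewrite ler_pM2l ?powR_gt0//; apply: le_trans le_uy.
  by rewrite ler_pM2l.
apply: ge_ereal_sup => _ [x xB <-].
have three0 : 0 < (3 : R) `^ alpha by exact: powR_gt0.
rewrite -lee_pdivrMl//; apply: le_ereal_inf_tmp => _ [y yB <-].
by rewrite lee_fin ler_pdivrMl// harnack.
Qed.
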